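(* Let $T$ be a convex geometric tree with cyclic chromatic number $\chi_c(T)=2$ that contains no crossing four-edge path and no member of the family $\mathcal P=\{P^0,P^1,P^2\}$. Then $T$ is a cg $z$-tree.
   Context: A convex geometric (cg) graph is a graph whose vertex set is cyclically ordered; equivalently vertices are points on a convex closed curve $\Omega$ and edges are chords. For points on $\Omega$, $a_1<\cdots<a_t$ means they are met in this order going clockwise. A cg graph $F$ is contained in a cg graph $G$ if there is an injective map $V(F)\to V(G)$ preserving the cyclic order and mapping edges to edges. Two edges cross if they meet at a point not on $\Omega$. A crossing four-edge path is a cg path with four edges in which some pair of edges cross. The cyclic chromatic number $\chi_c(G)$ is the least $m$ such that $V(G)$ can be partitioned into disjoint arcs $A_1,\dots,A_m$ of $\Omega$ with no edge having both endpoints in one $A_t$. The family $\mathcal P=\{P^0,P^1,P^2\}$: each $P^i$ is a cg forest consisting of two three-edge paths $P=abcd$ and $P'=a'b'c'd'$ such that the center edges $bc$ and $b'c'$ do not cross; $ab$ and $cd$ cross at a point $p$ and $a'b'$ and $c'd'$ cross at a point $p'$; if $\{b,c\}\ne\{b',c'\}$ then $p$ and $p'$ lie outside the region bounded by the segments $bc$, $b'c'$ and (arcs of) $\Omega$, while if $\{b,c\}=\{b',c'\}$ then $p$ and $p'$ lie on opposite sides of $bc=b'c'$; $bc$ and $b'c'$ share exactly $i$ endpoints and the two paths are otherwise vertex-disjoint, so $|V(P^i)|=8-i$. Ordered notions: an ordered graph has a linearly ordered vertex set. An increasing tree is an ordered tree defined recursively: a single edge is increasing; given an increasing tree with vertices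 split into intervals $I<J$ (edges go between $I$ and $J$) and longest edge $ij$ ($i\in I$, $j\in J$; length of $xy$ is $|x-y|$), adding a new vertex $j'>j$ with edge $ij'$, or a new vertex $i'<i$ with edge $i'j$, gives an increasing tree. A $z$-tree is an ordered tree with parts intervals $I<J$ which is the union of an increasing tree $T$ with longest edge $ij$ ($i\in I$, $j\in J$), a possibly empty set $S_j$ of edges $hj$ with new vertices $h\in I$, $h<i$, and a possibly empty set $S_i$ of edges $ik$ with new vertices $k\in J$, $k>j$. A cg increasing tree (resp. cg $z$-tree) is the cg tree obtained from an increasing tree (resp. a $z$-tree) on vertex set $[n]$ by regarding the linear order of its vertices as a cyclic order $n<n-1<\cdots<2<1$. *)

(* Defs.v *)
From mathcomp Require Import all_boot.
From mathcomp Require Import zify.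

Set Implicit Arguments.
Unset Strict Implicit.
Unset Printing Implicit Defensive.

(** [cyc x y z] means that [x], [y], [z] are distinct and met in this order
    going clockwise. *)
Record cgGraph := CgGraph {
  vertex :> finType;
  cyc : vertex -> vertex -> vertex -> bool;
  adj : rel vertex;
  cyc_rot : forall x y z, cyc x y z -> cyc y z x;
  cyc_asym : forall x y z, cyc x y z -> ~~ cyc z y x;
  cyc_trans : forall x y z w, cyc x y z -> cyc x z w -> cyc x y w;
  cyc_total : forall x y z, uniq [:: x; y; z] -> cyc x y z || cyc z y x;
  adj_sym : symmetric adj;
  adj_irr : irreflexive adj
}.

Definition contains (G F : cgGraph) : Prop :=
  exists f : F -> G,
    [/\ injective f,
        forall x y z, cyc x y z -> cyc (f x) (f y) (f z)
      & forall x y, adj x y -> adj (f x) (f y)].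

Definition cg_iso (G H : cgGraph) : Prop :=
  exists f : G -> H,
    [/\ bijective f,
        forall x y z, cyc (f x) (f y) (f z) = cyc x y z
      & forall x y, adj (f x) (f y) = adj x y].

(** The chords [ab] and [cd] meet at a point not on the curve iff their
    endpoints alternate.  Equivalently, [c] and [d] lie strictly on opposite
    sides of [ab]. *)
Definition cross (G : cgGraph) (a b c d : G) : bool :=
  (cyc a c b && cyc b d a) || (cyc a d b && cyc b c a).

Definition is_tree (G : cgGraph) : Prop :=
  [/\ 0 < #|G|,
      forall x y : G, connect (@adj G) x y
    & forall s : seq G, ucycle (@adj G) s -> size s <= 2].

Definition clockwise_arc (G : cgGraph) (u v : G) : {set G} :=
  [set x | [|| x == u, x == v | cyc u x v]].

Definition is_arc (G : cgGraph) (A : {set G}) : bool :=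
  [exists u, exists v, A == clockwise_arc u v].

Definition independent (G : cgGraph) (A : {set G}) : bool :=
  [forall x in A, forall y in A, ~~ adj x y].

Definition arc_colorable (G : cgGraph) (m : nat) : bool :=
  [exists P : {set {set G}},
     [&& partition P [set: G], #|P| == m
       & [forall A in P, is_arc A && independent A]]].

Lemma arc_colorable_ex (G : cgGraph) : exists m, arc_colorable G m.
Proof.
pose P := preim_partition (@id G) [set: G].
exists #|P|; apply/existsP; exists P.
rewrite eqxx preim_partitionP /=.
apply/forall_inP=> A /imsetP[x _ ->].
have -> : [set y in [set: G] | x == y] = [set x].
  by apply/setP=> y; rewrite !inE eq_sym.
apply/andP; split.
  apply/existsP; exists x; apply/existsP; exists x; apply/eqP/setP=> y.
  rewrite !inE; case: eqVneq => //= _.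
  by apply/esym/negP=> h; have := cyc_asym h; rewrite h.
apply/forall_inP=> y /set1P ->; apply/forall_inP=> z /set1P ->.
by rewrite adj_irr.
Qed.

Definition chi_c (G : cgGraph) : nat := ex_minn (arc_colorable_ex G).

Definition path_edge (V : eqType) (s : seq V) (x y : V) : bool :=
  ((x, y) \in zip s (behead s)) || ((y, x) \in zip s (behead s)).

Definition crossing_four_edge_path (F : cgGraph) : Prop :=
  (exists s : seq F,
     [/\ uniq s, size s = 5, forall x, x \in s
       & forall x y, adj x y = path_edge s x y]) /\
  (exists x y z w : F, [/\ adj x y, adj z w & cross x y z w]).

(** If [ab] and [cd] cross at [p], then [a], [d] and [p] all lie on the same
    side of [bc], so the position of [p] relative to [bc] is that of [a].

    When [{b,c} <> {b',c'}] and these chords do not cross, the region bounded by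
    [bc], [b'c'] and the curve lies on the side of [bc] that contains the
    endpoints of [b'c'] other than [b] and [c]; [p] lies outside it, beyond
    [bc], iff [a] is separated by [bc] from those endpoints. *)
Definition beyond (G : cgGraph) (b c b' c' a : G) : bool :=
  [forall x in [set b'; c'] :\: [set b; c], cross b c a x].

Definition is_P (i : nat) (F : cgGraph) : Prop :=
  exists a b c d a' b' c' d' : F,
    let P := [:: a; b; c; d] in
    let P' := [:: a'; b'; c'; d'] in
    [/\ uniq P, uniq P',
        forall x, (x \in P) || (x \in P')
      & forall x y, adj x y = path_edge P x y || path_edge P' x y] /\
    [/\ ~~ cross b c b' c',
        cross a b c d && cross a' b' c' d',
        if [set b; c] == [set b'; c'] then cross b c a a'
        else beyond b c b' c' a && beyond b' c' b c a',
        #|[set b; c] :&: [set b'; c']| = i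
      & [set:: P] :&: [set:: P'] = [set b; c] :&: [set b'; c']].

Definition in_family_P (F : cgGraph) : Prop :=
  exists i : 'I_3, is_P i F.

(** An edge of an ordered graph with parts [I < J] is the pair [(x, y)] with
    [x \in I] and [y \in J]. *)

Definition edge_length (n : nat) (e : 'I_n * 'I_n) : nat :=
  maxn e.1 e.2 - minn e.1 e.2.

Definition longest_edge (n : nat) (E : {set 'I_n * 'I_n}) (e : 'I_n * 'I_n) :=
  e \in E /\ forall e', e' \in E -> edge_length e' <= edge_length e.

Inductive increasing_tree (n : nat) :
  {set 'I_n} -> {set 'I_n} -> {set 'I_n * 'I_n} -> Prop :=
| IncEdge (i j : 'I_n) :
    i < j -> increasing_tree [set i] [set j] [set (i, j)]
| IncRight (I J : {set 'I_n}) (E : {set 'I_n * 'I_n}) (i j j' : 'I_n) :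
    increasing_tree I J E -> longest_edge E (i, j) ->
    j' \notin I :|: J -> j < j' ->
    increasing_tree I (j' |: J) ((i, j') |: E)
| IncLeft (I J : {set 'I_n}) (E : {set 'I_n * 'I_n}) (i j i' : 'I_n) :
    increasing_tree I J E -> longest_edge E (i, j) ->
    i' \notin I :|: J -> i' < i ->
    increasing_tree (i' |: I) J ((i', j) |: E).

Definition z_tree (n : nat) (I J : {set 'I_n}) (E : {set 'I_n * 'I_n}) : Prop :=
  (forall x y, x \in I -> y \in J -> x < y) /\
  exists (I0 J0 : {set 'I_n}) (E0 : {set 'I_n * 'I_n}) (i j : 'I_n)
         (H K : {set 'I_n}),
    [/\ increasing_tree I0 J0 E0, longest_edge E0 (i, j),
        forall h, h \in H -> h \notin I0 :|: J0 /\ h < i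
      & forall k, k \in K -> k \notin I0 :|: J0 /\ j < k] /\
    [/\ I = I0 :|: H, J = J0 :|: K
      & E = E0 :|: [set (h, j) | h in H] :|: [set (i, k) | k in K]].

Section CgOfOrdered.
Variables (n : nat) (E : {set 'I_n * 'I_n}).

(** Clockwise is decreasing, i.e. the cyclic order is [n < n-1 < ... < 1]. *)
Definition ord_cyc (x y z : 'I_n) : bool :=
  [|| z < y < x, x < z < y | y < x < z].

Definition ord_adj (x y : 'I_n) : bool :=
  (x != y) && (((x, y) \in E) || ((y, x) \in E)).

Lemma ord_cyc_rot x y z : ord_cyc x y z -> ord_cyc y z x.
Proof. by rewrite /ord_cyc; lia. Qed.

Lemma ord_cyc_asym x y z : ord_cyc x y z -> ~~ ord_cyc z y x.
Proof. by rewrite /ord_cyc; lia. Qed.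

Lemma ord_cyc_trans x y z w : ord_cyc x y z -> ord_cyc x z w -> ord_cyc x y w.
Proof. by rewrite /ord_cyc; lia. Qed.

Lemma ord_cyc_total x y z :
  uniq [:: x; y; z] -> ord_cyc x y z || ord_cyc z y x.
Proof. by rewrite /= !inE -!val_eqE /ord_cyc /=; lia. Qed.

Lemma ord_adj_sym : symmetric ord_adj.
Proof. by move=> x y; rewrite /ord_adj eq_sym orbC. Qed.

Lemma ord_adj_irr : irreflexive ord_adj.
Proof. by move=> x; rewrite /ord_adj eqxx. Qed.

Definition cg_of_ordered : cgGraph :=
  CgGraph ord_cyc_rot ord_cyc_asym ord_cyc_trans ord_cyc_total
          ord_adj_sym ord_adj_irr.

End CgOfOrdered.

Definition cg_z_tree (G : cgGraph) : Prop :=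
  exists (n : nat) (I J : {set 'I_n}) (E : {set 'I_n * 'I_n}),
    [/\ z_tree I J E, I :|: J = [set: 'I_n] & cg_iso G (cg_of_ordered E)].

(* Main.v *)
Require Import Defs.
From mathcomp Require Import all_boot all_order all_algebra.
From mathcomp Require Import zify.

Set Implicit Arguments.
Unset Strict Implicit.
Unset Printing Implicit Defensive.
Import Order.TTheory GRing.Theory Num.Theory.

(** Draw the two arcs of a proper 2-colouring on two parallel lines, so that
    "left" and "right" make sense on both.  A path with at least four edges has
    no crossing, hence it zigzags monotonically; so two crossing edges are the
    end edges of a three-edge path [abcd], whose ends [a] and [d] are leaves
    lying on one side of the center [bc].  Every vertex is on the other side of
    (or on) [bc], or is such a leaf; in particular there is at most one center
    with leaves on the right and at most one with leaves on the left, and if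
    both existed they would form a member of the family [P].  Choosing the
    linear order so that no center has its leaves on the inner side, the edges
    nested inside [bc] form a chain without crossings which, by connectedness,
    is an increasing tree with longest edge [bc]; the remaining edges are the
    two stars at [b] and [c].  If nothing crosses, the longest edge plays the
    role of [bc]. *)

(** * Drawings on two parallel lines and monotone zigzags *)

(* [s] tells on which line a vertex lies, and [r] increases to the right on each
   line; the values of [r] on different lines are never compared.  In [tl_leaf]
   the equality of booleans says that [ab] and [cd] cross. *)
Record two_line (V : finType) (adj : rel V) (s : V -> bool) (r : V -> int) :
  Prop := TwoLine {
  tl_sym : symmetric adj;
  tl_conn : forall x y, connect adj x y;
  tl_bip : forall x y, adj x y -> s y = ~~ s x;
  tl_inj : forall x y, s x = s y -> r x = r y -> x = y;
  tl_leaf : forall a b c d e, adj a b -> adj b c -> adj c d ->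
    a != c -> b != d -> (r a < r c)%R = (r d < r b)%R -> adj a e -> e = b }.

(** Mirror image: facts about ends on the right yield facts about ends on the left. The equality in
    [tl_leaf] survives because [a], [c] lie on one line and [b], [d] on the other, so neither
    comparison is a tie. *)
Lemma two_line_opp (V : finType) (adj : rel V) (s : V -> bool) (r : V -> int) :
  two_line adj s r -> two_line adj s (fun x => - r x)%R.
Proof.
case=> sy co bi inj lf; split=> // [x y e1 e2|a b c d e ab bc cd nac nbd h].
  by apply: inj => //; lia.
apply: (lf _ _ _ _ _ ab bc cd) => //.
have sac : s a = s c by rewrite (bi _ _ bc) (bi _ _ ab) negbK.
have sbd : s b = s d by rewrite (bi _ _ cd) (bi _ _ bc) negbK.
have n1 : r a <> r c by move=> h1; rewrite (inj _ _ sac h1) eqxx in nac.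
have n2 : r b <> r d by move=> h1; rewrite (inj _ _ sbd h1) eqxx in nbd.
lia.
Qed.

(* The condition on [z] or [p] puts the first three edges on a longer path. *)
Lemma two_line_zigzag (V : finType) (adj : rel V) (s : V -> bool) (r : V -> int)
    (u v w : V) (p : seq V) :
  two_line adj s r -> path adj u [:: v, w & p] -> uniq [:: u, v, w & p] ->
  (r w < r u)%R -> (exists2 z, adj u z & z != v) \/ 2 <= size p ->
  forall x, x \in w :: p -> (r x < r (if s x == s u then u else v))%R.
Proof.
move=> H; elim: p u v w => [|t p IH] u v w.
  move=> /and3P[uv vw _] _ wu _ x; rewrite inE => /eqP->.
  by rewrite (tl_bip H vw) (tl_bip H uv) negbK eqxx.
move=> /and4P[uv vw wt pt] un wu hz x.
have [nuw nvt nut] : [/\ u != w, v != t & u != t].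
  by move: un; rewrite /= !inE !negb_or => /and3P[/and4P[_ -> -> _] /and3P[_ -> _] _].
(* Otherwise [uv] and [wt] cross, and both ends of the path [u v w t] are leaves. But [u] has the
   further neighbour [z], or [t] has a successor [y] on the path. *)
have tv : (r t < r v)%R.
  have st : s t = s v by rewrite (tl_bip H wt) (tl_bip H vw) negbK.
  have [//|] := boolP (r t < r v)%R => ntv; exfalso.
  case: hz => [[z uz zv]|].
    have := @tl_leaf _ _ _ _ H u v w t z uv vw wt nuw nvt.
    rewrite ltNge (ltW wu) (negbTE ntv) => /(_ erefl uz) e.
    by rewrite e eqxx in zv.
  case: p {IH} un pt => // y p un /andP[ty _] _.
  have e : y = w; last by move: un; rewrite e /= !inE eqxx !orbT /= !andbF.
  apply: (@tl_leaf _ _ _ _ H t w v u y) => //; try by rewrite (tl_sym H).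
  - by rewrite eq_sym.
  - by rewrite eq_sym.
  by rewrite (negbTE ntv) ltNge (ltW wu).
rewrite inE => /predU1P[->|xt].
  by rewrite (tl_bip H vw) (tl_bip H uv) negbK eqxx.
have unv : uniq [:: v, w, t & p] by case/andP: un.
have pv : path adj v [:: w, t & p] by apply/and3P.
(* After the first step, [u] is the further neighbour required of [v]. *)
have hz' : (exists2 z, adj v z & z != w) \/ 1 < size p.
  by left; exists u => //; rewrite (tl_sym H).
have := IH v w t pv unv tv hz' x xt; rewrite (tl_bip H uv); case: (s x); case: (s u) => //= h.
  exact: lt_trans h wu.
exact: lt_trans h wu.
Qed.

(** A simple path from [u] to [x] either meets [v], and its portion before [v] is replaced by the
    edge [uv], or avoids [v], and [v] is put in front. *)
Lemma connect_edge_path (V : finType) (adj : rel V) (u v x : V) :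
  symmetric adj -> connect adj u x -> adj u v -> u != v -> x != u -> x != v ->
  exists u' v' w p, [/\ (u', v') = (u, v) \/ (u', v') = (v, u),
    path adj u' [:: v', w & p], uniq [:: u', v', w & p] & last w p = x].
Proof.
move=> sy /connectP[p0 pp0 ->] uv uv'; case/shortenP: pp0 => p pp un _ xu xv.
have [vp|vp] := boolP (v \in p).
  case/splitPr: vp pp un xu xv => p1 [|w p2].
    by rewrite last_cat /= eqxx.
  rewrite cat_path last_cat /= => /and3P[_ _ /andP[vw pw]] /andP[nu un] _ _.
  exists u, v, w, p2; split=> //; first by left.
    by rewrite /= uv vw pw.
  move: nu un; rewrite mem_cat negb_or => /andP[_ nu].
  by rewrite cat_uniq cons_uniq nu => /and3P[].
case: p pp un xu xv vp => [|w p]; first by rewrite /= eqxx.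
move=> pw un _ _ vp; exists v, u, w, p; split=> //; first by right.
  by rewrite /= sy uv.
by rewrite cons_uniq un andbT inE negb_or vp eq_sym uv'.
Qed.

Lemma tl_neq (V : finType) (adj : rel V) (s : V -> bool) (r : V -> int) x y :
  two_line adj s r -> adj x y -> x != y.
Proof.
by move=> H /(tl_bip H) xy; apply/eqP=> e; move: xy; rewrite e; case: (s y).
Qed.

(** * Centers of crossing three-edge paths: domination and uniqueness *)

(* The ends [a] and [d] of the crossing path [abcd] lie to the right of [bc];
   replacing [r] by its opposite gives the centers with ends on the left. *)
Definition outer_center (V : finType) (adj : rel V) (r : V -> int) (b c : V) :=
  adj b c /\ exists a d, [/\ adj a b, adj c d, (r c < r a)%R & (r b < r d)%R].

Lemma outer_centerC (V : finType) (adj : rel V) (r : V -> int) (b c : V) :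
  symmetric adj -> outer_center adj r b c -> outer_center adj r c b.
Proof.
move=> sy [bc [a [d [ab cd ca bd]]]]; split; first by rewrite sy.
by exists d, a; split=> //; rewrite sy.
Qed.

Lemma outer_center_dominates (V : finType) (adj : rel V) (s : V -> bool)
    (r : V -> int) (b c x : V) :
  two_line adj s r -> outer_center adj r b c -> s x = s b ->
  (r x <= r b)%R \/ adj c x /\ forall e, adj x e -> e = c.
Proof.
move=> H bc_c sx; have [bc [a [d [ab cd ca bd]]]] := bc_c.
have [->|xb] := eqVneq x b; first by left.
have xc : x != c.
  by apply/eqP=> xc; move: sx; rewrite xc (tl_bip H bc); case: (s b).
(* This treats paths leaving the center through [c]; exchanging the roles of [b] and [c] covers the
   others. *)
have hx : forall b c a d w p, adj b c -> adj a b -> adj c d ->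
    (r c < r a)%R -> (r b < r d)%R -> path adj b [:: c, w & p] ->
    uniq [:: b, c, w & p] ->
    (r (last w p) < r (if s (last w p) == s b then b else c))%R \/
    [/\ s (last w p) = s b, adj c (last w p) &
      forall e, adj (last w p) e -> e = c].
  move: H => {sx xb xc bc_c bc ab cd ca bd x b c a d} H.
  move=> b c a d w p bc ab cd ca bd pp un.
  (* If [w] is to the left of [b], the path zigzags to the left for good, [a] being the further
     neighbour of [b]. Otherwise [wc] and [ba] cross, so [w] is a leaf and the path ends there. *)
  have [wb|bw] := boolP (r w < r b)%R.
    left; apply: (two_line_zigzag H pp un wb); last exact: mem_last.
    left; exists a; first by rewrite (tl_sym H).
    by apply/eqP=> e; rewrite e ltxx in ca.
  right; case/and3P: pp => _ cw pw.
  have bw' : b != w by move: un; rewrite /= !inE !negb_or => /andP[/and3P[]].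
  have lw : forall e, adj w e -> e = c.
    move=> e; apply: (@tl_leaf _ _ _ _ H w c b a); try by rewrite (tl_sym H).
    - by rewrite eq_sym.
    - by apply/eqP=> e'; rewrite e' ltxx in ca.
    - by rewrite (negbTE bw) ltNge (ltW ca).
  case: p pw un => [_ _|y p].
    by rewrite /= (tl_bip H cw) (tl_bip H bc) negbK.
  move=> /andP[/lw -> _]; by rewrite /= !inE eqxx !orbT /= andbF.
have [u [v [w [p [uv pp un lx]]]]] :=
  connect_edge_path (tl_sym H) (tl_conn H b x) bc (tl_neq H bc) xb xc.
case: uv => -[eu ev]; subst u v.
  have := hx b c a d w p bc ab cd ca bd pp un; rewrite lx sx eqxx.
  by case=> [h|[_ h1 h2]]; [left; exact: ltW | right].
have cb : adj c b by rewrite (tl_sym H).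
have ba : adj b a by rewrite (tl_sym H).
have dc : adj d c by rewrite (tl_sym H).
have := hx c b d a w p cb dc ba bd ca pp un.
rewrite lx sx (tl_bip H bc); case: (s b) => /= -[h|[]] //; left; exact: ltW.
Qed.

(** Some path starts with the edge [xy], in one direction or the other, and contains [x'] and [y'].
    With four or more edges it zigzags to one side, which would put [x'] and [y'] on the same side
    of [xy]; so it has at most three edges, and the adjacency is read off. *)
Lemma crossing_edges_adjacent (V : finType) (adj : rel V) (s : V -> bool)
    (r : V -> int) (x y x' y' : V) :
  two_line adj s r -> adj x y -> adj x' y' -> s x = s x' ->
  (r x < r x')%R -> (r y' < r y)%R -> adj x y' \/ adj y x'.
Proof.
move=> H xy xy' sx rx ry.
have sy : s y = s y' by rewrite (tl_bip H xy) (tl_bip H xy') sx.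
have s_neq u v : s u = ~~ s v -> u != v.
  by move=> h; apply/eqP=> e; move: h; rewrite e; case: (s v).
have nxx : x' != x by apply/eqP=> e; rewrite e ltxx in rx.
have nyy : y' != y by apply/eqP=> e; rewrite e ltxx in ry.
have nxy : x' != y by apply: s_neq; rewrite (tl_bip H xy) negbK.
have nyx : y' != x by apply: s_neq; rewrite (tl_bip H xy') sx.
have [u [v [w [p [uv pp un wx wy]]]]] : exists u v w p,
    [/\ (u, v) = (x, y) \/ (u, v) = (y, x), path adj u [:: v, w & p],
    uniq [:: u, v, w & p], x' \in w :: p & y' \in w :: p].
  have [u [v [w [p [uv pp un lx]]]]] :=
    connect_edge_path (tl_sym H) (tl_conn H x x') xy (tl_neq H xy) nxx nxy.
  have lp : x' \in w :: p by rewrite -lx mem_last.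
  have [yp|yp] := boolP (y' \in w :: p); first by exists u, v, w, p.
  exists u, v, w, (rcons p y'); split=> //.
  - by rewrite -!rcons_cons rcons_path pp /= lx.
  - rewrite -!rcons_cons rcons_uniq un andbT !inE.
    by move: yp; rewrite inE; case: uv => -[-> ->]; rewrite (negbTE nyx) (negbTE nyy).
  - by rewrite -rcons_cons mem_rcons inE lp orbT.
  by rewrite -rcons_cons mem_rcons inE eqxx.
have suv : s v = ~~ s u by case/andP: pp => /(tl_bip H).
have [sp|sp] := leqP 2 (size p).
  have sw : s w = s u.
    by case/and3P: pp => _ /(tl_bip H) -> _; rewrite suv negbK.
  have nrw : r w <> r u.
    by move/(tl_inj H sw) => e; move: un; rewrite e /= !inE eqxx !orbT.
  have [wu|uw] := boolP (r w < r u)%R.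
    have z := two_line_zigzag H pp un wu (or_intror sp).
    move: (z _ wx) (z _ wy); rewrite -sx -sy.
    by case: uv => -[-> ->]; rewrite (tl_bip H xy) eqxx; case: (s x) => /= h _;
      rewrite ltNge (ltW h) in rx.
  have {uw} uw : (- r w < - r u)%R.
    by rewrite ltrN2 lt_neqAle eq_sym leNgt uw andbT; apply/eqP.
  have z := two_line_zigzag (two_line_opp H) pp un uw (or_intror sp).
  move: (z _ wx) (z _ wy); rewrite -sx -sy.
  by case: uv => -[-> ->]; rewrite (tl_bip H xy) eqxx !ltrN2;
    case: (s x) => /= _ h; rewrite ltNge (ltW h) in ry.
case: p sp pp un wx wy => [|t [|//]] _.
  rewrite !inE => _ _ /eqP ex /eqP ey.
  by have := tl_neq H xy'; rewrite ex ey eqxx.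
move=> /and3P[_ vw _] _.
rewrite !inE => /orP[]/eqP ex /orP[]/eqP ey; subst x' y'.
- by have := tl_neq H xy'; rewrite eqxx.
- case: uv => -[eu ev]; subst u v; last by move/(tl_bip H): vw; rewrite sx; case: (s w).
  by right.
- case: uv => -[eu ev]; subst u v; first by move/(tl_bip H): vw; rewrite sy; case: (s w).
  by left.
- by have := tl_neq H xy'; rewrite eqxx.
Qed.

(** The connecting edge completes a three-edge path whose ends lie on the right if it is [xy'] and
    on the left if it is [x'y]. *)
Lemma crossing_edges_center (V : finType) (adj : rel V) (s : V -> bool)
    (r : V -> int) (x y x' y' : V) :
  two_line adj s r -> adj x y -> adj x' y' -> s x = s x' ->
  (r x < r x')%R -> (r y' < r y)%R ->
  outer_center adj r x y' \/ outer_center adj (fun z => - r z)%R x' y.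
Proof.
move=> H xy xy' sx rx ry.
have [h|h] := crossing_edges_adjacent H xy xy' sx rx ry; [left|right].
  by split=> //; exists y, x'; split; rewrite // (tl_sym H).
split; first by rewrite (tl_sym H).
by exists y', x; split; rewrite ?ltrN2 // (tl_sym H).
Qed.

(** Each center dominates the endpoints of the other: an endpoint beyond it would be a leaf, whereas
    both endpoints of a center have two neighbours. The inequalities hold in both directions. *)
Lemma outer_center_unique (V : finType) (adj : rel V) (s : V -> bool)
    (r : V -> int) (b c b' c' : V) :
  two_line adj s r -> outer_center adj r b c -> outer_center adj r b' c' ->
  s b = s b' -> b = b' /\ c = c'.
Proof.
have le : forall b c b' c', two_line adj s r -> outer_center adj r b c ->
    outer_center adj r b' c' -> s b = s b' -> (r b <= r b')%R.
  move=> {}b {}c {}b' {}c' H h h' sb.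
  case: (outer_center_dominates H h' sb) => // -[cb lf].
  have [bc [a [d [ab cd ca bd]]]] := h.
  have e1 := lf _ bc; have e2 : a = c' by apply: lf; rewrite (tl_sym H).
  by move: ca; rewrite e1 e2 ltxx.
move=> H h h' sb.
have hc := outer_centerC (tl_sym H) h; have hc' := outer_centerC (tl_sym H) h'.
have sc : s c = s c' by rewrite (tl_bip H h.1) (tl_bip H h'.1) sb.
have := (le _ _ _ _ H h h' sb, le _ _ _ _ H h' h (esym sb),
  le _ _ _ _ H hc hc' sc, le _ _ _ _ H hc' hc (esym sc)).
by case=> [[[h1 h2] h3] h4]; split; apply: (tl_inj H) => //; apply/le_anti/andP.
Qed.

(** * Increasing trees and z-trees from nested edges in a linear order *)

Lemma outermost_edge n (E : {set 'I_n * 'I_n}) :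
  E != set0 -> {in E, forall e : 'I_n * 'I_n, e.1 < e.2} ->
  {in E &, forall e e' : 'I_n * 'I_n, e.1 < e'.1 -> e'.2 <= e.2} ->
  exists2 e, e \in E & {in E, forall e' : 'I_n * 'I_n, e.1 <= e'.1 /\ e'.2 <= e.2}.
Proof.
case/set0Pn => e0 e0E lt nest.
case: (@arg_maxnP _ e0 (mem E) (fun e => e.2 - e.1) e0E) => e eE emax.
exists e => // e' e'E; have := emax _ e'E.
have := (nest _ _ eE e'E, nest _ _ e'E eE); have := lt _ eE; have := lt _ e'E.
move=> /= ? ? [? ?] ?; split; lia.
Qed.

Lemma outermost_longest n (E : {set 'I_n * 'I_n}) e :
  e \in E -> {in E, forall e : 'I_n * 'I_n, e.1 < e.2} ->
  {in E, forall e' : 'I_n * 'I_n, e.1 <= e'.1 /\ e'.2 <= e.2} -> longest_edge E e.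
Proof.
move=> eE lt out; split=> // e' e'E.
have [] := out _ e'E; have := lt _ e'E; have := lt _ eE.
by rewrite /edge_length => /= *; lia.
Qed.

(* The last hypothesis makes consecutive edges of the chain share an endpoint. *)
Lemma chain_increasing_tree n (E : {set 'I_n * 'I_n}) (k : nat) :
  E != set0 -> {in E, forall e : 'I_n * 'I_n, e.1 < k <= e.2} ->
  {in E &, forall e e' : 'I_n * 'I_n, e.1 < e'.1 -> e'.2 <= e.2} ->
  {in E &, forall e e' : 'I_n * 'I_n, e'.1 < e.1 -> e.2 < e'.2 -> exists2 e'', e'' \in E &
    [/\ e'' != e, e'' != e', e'.1 <= e''.1 <= e.1 & e.2 <= e''.2 <= e'.2]} ->
  increasing_tree [set e.1 | e in E] [set e.2 | e in E] E.
Proof.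
move: {2}#|E| (leqnn #|E|) => m; elim: m E => [|m IH] E.
  by rewrite leqn0 cards_eq0 => /eqP->; rewrite eqxx.
move=> cE En0 hk nest linked.
have lt : {in E, forall e : 'I_n * 'I_n, e.1 < e.2} by move=> e /hk; lia.
have [[i' j'] eE out] := outermost_edge En0 lt nest.
set e' := (i', j') in eE out; set E' := E :\ e'.
have EE : E = e' |: E' by rewrite setD1K.
have sub : {subset E' <= E} by move=> e; rewrite !inE => /andP[].
have [E0|E'n0] := eqVneq E' set0.
  rewrite EE E0 setU0 !imset_set1; apply: IncEdge; exact: (lt _ eE).
have inc : increasing_tree [set e.1 | e in E'] [set e.2 | e in E'] E'.
  apply: IH => //.
  - by move: cE; rewrite (cardsD1 e') eE.
  - by move=> e /sub/hk.
  - by move=> e e1 /sub h /sub; apply: nest.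
  move=> e e1 h h1 l1 l2.
  have [e2 e2E [n1 n2 b1 b2]] := linked e e1 (sub _ h) (sub _ h1) l1 l2.
  (* The linking edge survives the removal of [e']: as [e'] is outermost, it could only link if it
     coincided with [e1]. *)
  exists e2 => //; rewrite !inE e2E andbT; apply/eqP=> e2e'; subst e2.
  have [o1 o2] := out _ (sub _ h1).
  case/eqP: n2; case: (e1) o1 o2 b1 b2 => x y /= o1 o2 /andP[b1 _] /andP[_ b2].
  by congr pair; apply/val_inj/anti_leq/andP.
have lt' : {in E', forall e : 'I_n * 'I_n, e.1 < e.2} by move=> e /sub/lt.
have [[i j] e0E' out'] : exists2 e, e \in E' &
    {in E', forall e' : 'I_n * 'I_n, e.1 <= e'.1 /\ e'.2 <= e.2}.
  by apply: outermost_edge => // e e1 /sub h /sub; apply: nest.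
have lon := outermost_longest e0E' lt' out'.
have [/= oi oj] := out _ (sub _ e0E').
have notin (x : 'I_n) : x < k -> x \notin [set e.2 | e in E'].
  by move=> xk; apply/imsetP=> -[[y z] /sub/hk /= h ex]; move: xk; rewrite ex; lia.
have notin' (x : 'I_n) : k <= x -> x \notin [set e.1 | e in E'].
  by move=> xk; apply/imsetP=> -[[y z] /sub/hk /= h ex]; move: xk; rewrite ex; lia.
have /= /andP[ik jk] := hk _ eE.
have [/= ne _] : (i, j) != e' /\ true by move: e0E'; rewrite !inE => /andP[].
have [ii|ii] := eqVneq i' i.
  have jj : j < j'.
    rewrite ltn_neqAle oj andbT; apply: contraNneq ne => jj.
    by apply/eqP; congr pair => //; apply: val_inj.
  have I1 : [set e.1 | e in E] = [set e.1 | e in E'].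
    rewrite EE imsetU1; apply/setUidPr; rewrite sub1set; apply/imsetP.
    by exists (i, j).
  have J1 : [set e.2 | e in E] = j' |: [set e.2 | e in E'] by rewrite EE imsetU1.
  rewrite I1 J1 EE /e' ii; apply: (IncRight inc lon) => //.
  rewrite inE negb_or notin' //=; apply/imsetP=> -[[y z] h /= ex].
  by have [_] := out' _ h; rewrite -ex /= => *; lia.
have [jj|jj] := eqVneq j' j.
  have {}ii : i' < i.
    by rewrite ltn_neqAle oi andbT.
  have I1 : [set e.2 | e in E] = [set e.2 | e in E'].
    rewrite EE imsetU1; apply/setUidPr; rewrite sub1set; apply/imsetP.
    by exists (i, j).
  have J1 : [set e.1 | e in E] = i' |: [set e.1 | e in E'] by rewrite EE imsetU1.
  rewrite I1 J1 EE /e' jj; apply: (IncLeft inc lon) => //.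
  rewrite inE negb_or notin // andbT; apply/imsetP=> -[[y z] h /= ex].
  by have [] := out' _ h; rewrite -ex /= => *; lia.
(* If neither endpoint is shared, [linked] gives a third edge between [(i, j)] and [e']; it lies in
   [E'], where [(i, j)] is outermost, so it equals [(i, j)], a contradiction. *)
have l1 : i' < i by rewrite ltn_neqAle ii.
have l2 : j < j' by rewrite ltn_neqAle eq_sym jj.
have [[x y] eE2 [/= n1 n2 b1 b2]] := linked _ _ (sub _ e0E') eE l1 l2.
have [/= o1 o2] : i <= x /\ y <= j by apply: (out' (x, y)); rewrite !inE n2.
case/andP: b1 => _ b1; case/andP: b2 => b2 _.
by case/eqP: n1; congr pair; apply/val_inj/anti_leq/andP.
Qed.

(** The hypothesis on [W] is connectedness: a vertex set that no edge leaves is empty or everything.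
    It supplies the linking edges of the chain inside [bc] and rules out isolated vertices. *)
Lemma center_z_tree n (E : {set 'I_n * 'I_n}) (k : nat) (b c : 'I_n) :
  (b, c) \in E -> {in E, forall e : 'I_n * 'I_n, e.1 < k <= e.2} ->
  {in E, forall e : 'I_n * 'I_n, [\/ b <= e.1 /\ e.2 <= c, e.2 = c /\ e.1 < b
                     | e.1 = b /\ c < e.2]} ->
  {in [set e in E | (b <= e.1) && (e.2 <= c)] &,
    forall e e' : 'I_n * 'I_n, e.1 < e'.1 -> e'.2 <= e.2} ->
  (forall W : pred 'I_n, {in E, forall e : 'I_n * 'I_n, W e.1 = W e.2} ->
    forall x y, W x = W y) ->
  z_tree [set x : 'I_n | x < k] [set x : 'I_n | k <= x] E.
Proof.
move=> bcE hk dom nest conn; split.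
  by move=> x y; rewrite !inE; lia.
set E0 := [set e in E | _] in nest.
have sub : {subset E0 <= E} by move=> e; rewrite inE => /andP[].
have bcE0 : (b, c) \in E0 by rewrite inE bcE !leqnn.
have lt : {in E0, forall e : 'I_n * 'I_n, e.1 < e.2} by move=> e /sub/hk; lia.
have out : {in E0, forall e' : 'I_n * 'I_n, (b, c).1 <= e'.1 /\ e'.2 <= (b, c).2}.
  by move=> e; rewrite inE => /andP[_ /andP[]].
have /= /andP[bk ck] := hk _ bcE.
exists [set e.1 | e in E0], [set e.2 | e in E0], E0, b, c,
  [set h | ((h, c) \in E) && (h < b)], [set h | ((b, h) \in E) && (c < h)].
have deg (x : 'I_n) : exists2 e, e \in E & x = e.1 \/ x = e.2.
  have [/exists_inP[e eE /orP[]/eqP ->]|/exists_inPn no] :=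
    boolP [exists e in E, (x == e.1) || (x == e.2)].
  - by exists e => //; left.
  - by exists e => //; right.
  have W1 : {in E, forall e : 'I_n * 'I_n, pred1 x e.1 = pred1 x e.2}.
    move=> e /no; rewrite negb_or /= ![_ == x]eq_sym.
    by case/andP=> /negbTE-> /negbTE->.
  have W2 y : y = x by apply/eqP; rewrite [_ == _](conn _ W1 y x) /= eqxx.
  by move: bk ck; rewrite (W2 b) (W2 c); lia.
split; split.
- apply: (chain_increasing_tree (k := k)) => //.
  + by apply/set0Pn; exists (b, c).
  + by move=> e /sub/hk.
  move=> [i j] [i' j'] eE e'E /= l1 l2.
  have [/exists_inP[e h /and4P[h1 h2 h3 h4]]|/exists_inPn no] := boolP
    [exists e in E0, [&& e != (i, j), e != (i', j'), i' <= e.1 <= i & j <= e.2 <= j']].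
    by exists e.
  (* Without a linking edge, no edge leaves the interval from [i] to [j]: chain edges are nested,
     and the star edges have both endpoints outside it. Yet [b] lies outside this interval. *)
  have W1 : {in E, forall e : 'I_n * 'I_n, [pred v : 'I_n | i <= v <= j] e.1 = (i <= e.2 <= j)}.
    have [/= oi oj] := out _ eE; have [/= oi' oj'] := out _ e'E.
    have /= hk1 := hk _ (sub _ eE); have /= hk2 := hk _ (sub _ e'E).
    move=> [x y] xyE; have /= hk3 := hk _ xyE.
    case: (dom _ xyE) => /= -[d1 d2]; last 2 first.
    + by rewrite d1; lia.
    + by rewrite d1; lia.
    have xyE0 : (x, y) \in E0 by rewrite inE xyE d1 d2.
    have := no _ xyE0; rewrite /= !xpair_eqE -!val_eqE /=.
    have /= := (nest _ _ xyE0 eE, nest _ _ xyE0 e'E, nest _ _ eE xyE0, nest _ _ e'E xyE0).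
    by case=> [[[N1 N2] N3] N4]; lia.
  have := conn _ W1 i b; rewrite /= leqnn.
  have [/= oi oj] := out _ e'E.
  have /= := hk _ (sub _ eE); lia.
- exact: outermost_longest.
- move=> h; rewrite inE => /andP[_ hb]; split=> //; rewrite inE negb_or.
  apply/andP; split; apply/imsetP=> -[[y z] eE /= ex].
    by have [] := out _ eE; rewrite -ex /= => *; lia.
  by have := hk _ (sub _ eE); rewrite -ex /=; lia.
- move=> h; rewrite inE => /andP[_ hb]; split=> //; rewrite inE negb_or.
  apply/andP; split; apply/imsetP=> -[[y z] eE /= ex].
    by have := hk _ (sub _ eE); rewrite -ex /=; lia.
  by have [] := out _ eE; rewrite -ex /= => *; lia.
- apply/setP=> x; rewrite !inE; apply/idP/idP.
    move=> xk; have [[y z] eE /= [ex|ex]] := deg x; have /= hke := hk _ eE; last first.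
      by move: xk; rewrite ex; lia.
    subst x; case: (dom _ eE) => /= -[d1 d2].
    + apply/orP; left; apply/imsetP; exists (y, z) => //.
      by rewrite inE eE d1.
    + by rewrite -d1 eE d2 orbT.
    by apply/orP; left; apply/imsetP; exists (b, c).
  case/orP=> [/imsetP[[y z] /sub/hk /= h ->]|/andP[_]]; first by lia.
  by lia.
- apply/setP=> x; rewrite !inE; apply/idP/idP.
    move=> xk; have [[y z] eE /= [ex|ex]] := deg x; have /= hke := hk _ eE.
      by move: xk; rewrite ex; lia.
    subst x; case: (dom _ eE) => /= -[d1 d2].
    + apply/orP; left; apply/imsetP; exists (y, z) => //.
      by rewrite inE eE d1.
    + by apply/orP; left; apply/imsetP; exists (b, c).
    by rewrite -d1 eE d2 orbT.
  case/orP=> [/imsetP[[y z] /sub/hk /= h ->]|/andP[_]]; first by lia.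
  by lia.
apply/setP=> -[x y]; apply/idP/idP.
  move=> eE; rewrite !inE eE /=; case: (dom _ eE) => /= -[d1 d2].
  - by rewrite d1 d2.
  - apply/orP; left; apply/orP; right; apply/imsetP; exists x; last by rewrite d1.
    by rewrite inE -d1 eE.
  apply/orP; right; apply/imsetP; exists y; last by rewrite d1.
  by rewrite inE -d1 eE.
case/setUP=> [/setUP[/sub//|]|] /imsetP[z]; rewrite inE => /andP[zE _] [-> ->] //.
Qed.

(** * Forbidden configurations as subgraphs of a cg graph *)

Lemma path_edge_sym (V : eqType) (p : seq V) : symmetric (path_edge p).
Proof. by move=> x y; rewrite /path_edge orbC. Qed.

Lemma path_edge_irr (V : eqType) (p : seq V) :
  uniq p -> irreflexive (path_edge p).
Proof.
move=> up x; rewrite /path_edge orbb.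
elim: p up => // y [|z p] //= IH /andP[yp up].
rewrite inE IH // orbF xpair_eqE; apply/andP=> -[/eqP-> /eqP e].
by move: yp; rewrite e inE eqxx.
Qed.

Lemma path_edge_map (V W : eqType) (f : V -> W) (p : seq V) x y :
  injective f -> path_edge (map f p) (f x) (f y) = path_edge p x y.
Proof.
move=> fi; pose ff (e : V * V) := (f e.1, f e.2).
have ffi : injective ff by move=> [? ?] [? ?] [/fi-> /fi->].
have zipE (s t : seq V) : zip (map f s) (map f t) = map ff (zip s t).
  by elim: s t => [|u s IH] [|v t] //=; rewrite IH.
by rewrite /path_edge behead_map zipE -!(mem_map ffi).
Qed.

(** The forbidden graphs prescribe their edges exactly, while containment need not be induced; hence
    the edge relation is given separately from the vertex set. *)
Definition sub_cg (G : cgGraph) (X : pred G) (e : rel G)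
    (es : symmetric e) (ei : irreflexive e) : cgGraph :=
  @CgGraph {x | X x} (fun x y z => cyc (val x) (val y) (val z))
    (fun x y => e (val x) (val y))
    (fun x y z => @cyc_rot G _ _ _) (fun x y z => @cyc_asym G _ _ _)
    (fun x y z w => @cyc_trans G _ _ _ _)
    (fun x y z u => cyc_total (etrans (map_inj_uniq val_inj [:: x; y; z]) u))
    (fun x y => es _ _) (fun x => ei _).

Lemma sub_cg_contained (G : cgGraph) (X : pred G) (e : rel G)
    (es : symmetric e) (ei : irreflexive e) :
  subrel e (@adj G) -> contains G (sub_cg X es ei).
Proof.
by move=> sub; exists val; split=> [|x y z|x y /sub] //; apply: val_inj.
Qed.

Lemma path_edge_adj (G : cgGraph) (p : seq G) :
  sorted (@adj G) p -> subrel (path_edge p) (@adj G).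
Proof.
case: p => [|x p] //=; elim: p x => [|y p IH] x //= /andP[xy yp] u v.
case/orP; rewrite inE => /orP[/eqP[-> ->]|h] //; last 2 first.
- by rewrite adj_sym.
- by apply: (IH y) => //; rewrite /path_edge h orbT.
by apply: (IH y) => //; rewrite /path_edge h.
Qed.

(** A second neighbour [e] of [a] would prolong [abcd] to a crossing four-edge path; acyclicity
    makes the five vertices distinct. *)
Lemma crossing_path_leaf (T : cgGraph) (a b c d e : T) :
  is_tree T ->
  (forall F : cgGraph, crossing_four_edge_path F -> ~ contains T F) ->
  adj a b -> adj b c -> adj c d -> a != c -> b != d -> cross a b c d ->
  adj a e -> e = b.
Proof.
move=> [_ _ acyc] hpath ab bc cd nac nbd cr ae; apply/eqP/negPn/negP => neb.
have neq (x y : T) : adj x y -> x != y.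
  by move=> h; apply/eqP=> e0; move: h; rewrite e0 adj_irr.
have nab := neq _ _ ab; have nbc := neq _ _ bc.
have ncd := neq _ _ cd; have nae := neq _ _ ae.
have no3 : ~~ adj c a.
  apply/negP=> ca; have := acyc [:: a; b; c].
  by rewrite /ucycle /= ab bc ca !inE negb_or nab nac nbc => /(_ isT).
have nad : a != d by apply/eqP=> h; rewrite h cd in no3.
have nec : e != c by apply/eqP=> h; rewrite adj_sym -h ae in no3.
have ned : e != d.
  apply/eqP=> h; have := acyc [:: a; b; c; d].
  rewrite /ucycle /= ab bc cd !inE !negb_or nab nac nad nbc nbd ncd.
  by rewrite -h adj_sym ae => /(_ isT).
pose p := [:: e; a; b; c; d].
have up : uniq p.
  by rewrite /= !inE !negb_or nab nac nad nbc nbd ncd neb nec ned eq_sym nae.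
have sp : sorted (@adj T) p by rewrite /= adj_sym ae ab bc cd.
pose F := sub_cg (mem p) (path_edge_sym p) (path_edge_irr up).
have mem (x : T) : x \in p -> exists y : F, val y = x by move=> h; exists (Sub x h).
have [|e' Ee] := mem e; first by rewrite !inE eqxx ?orbT.
have [|a' Ea] := mem a; first by rewrite !inE eqxx ?orbT.
have [|b' Eb] := mem b; first by rewrite !inE eqxx ?orbT.
have [|c' Ec] := mem c; first by rewrite !inE eqxx ?orbT.
have [|d' Ed] := mem d; first by rewrite !inE eqxx ?orbT.
have Ep : p = map val [:: e'; a'; b'; c'; d'] by rewrite /= Ee Ea Eb Ec Ed.
apply: (hpath F); last exact: sub_cg_contained (path_edge_adj sp).
split.
  exists [:: e'; a'; b'; c'; d']; split=> //.
  - by rewrite -(map_inj_uniq val_inj) -Ep.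
  - by move=> x; rewrite -(mem_map val_inj) -Ep; apply: (valP x).
  move=> x y; rewrite -(path_edge_map [:: e'; a'; b'; c'; d'] x y val_inj).
  by rewrite -Ep.
exists a', b', c', d'; split; last by rewrite /cross /= Ea Eb Ec Ed.
  by rewrite /= Ea Eb /path_edge /p /= !inE eqxx !orbT.
by rewrite /= Ec Ed /path_edge /p /= !inE eqxx !orbT.
Qed.

(** Clockwise is decreasing, as in [ord_cyc], so that a bijective coordinate transports the cyclic
    order to the ordered model. *)
Definition linear_coordinate (G : cgGraph) (h : G -> nat) : Prop :=
  injective h /\ forall x y z, cyc x y z =
    [|| h z < h y < h x, h x < h z < h y | h y < h x < h z].

(** The positions are [d' < b' <= b < d < a < c <= c' < a']: [bc] is nested in [b'c'], the ends of
    the first path lie inside [bc], those of the second outside [b'c']. Each of the equalities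
    [b' = b] and [c = c'] is one shared endpoint, so all three members are treated at once. *)
Lemma family_P_contained (G : cgGraph) (h : G -> nat)
    (a b c d a' b' c' d' : G) :
  linear_coordinate h ->
  sorted (@adj G) [:: a; b; c; d] -> sorted (@adj G) [:: a'; b'; c'; d'] ->
  h d' < h b' <= h b -> h b < h d < h a -> h a < h c <= h c' -> h c' < h a' ->
  exists2 F, in_family_P F & contains G F.
Proof.
move=> [hi hc] sp sp' h1 h2 h3 h4.
have eqh (x y : G) : (x == y) = (h x == h y) by rewrite (inj_eq hi).
pose p := [:: a; b; c; d]; pose p' := [:: a'; b'; c'; d'].
have up : uniq p by rewrite /= !inE !eqh; lia.
have up' : uniq p' by rewrite /= !inE !eqh; lia.
pose e x y := path_edge p x y || path_edge p' x y.
have es : symmetric e by move=> x y; rewrite /e !(path_edge_sym _ x).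
have ei : irreflexive e by move=> x; rewrite /e !path_edge_irr.
pose X := [pred x | (x \in p) || (x \in p')].
pose F := sub_cg X es ei.
exists F; last first.
  by apply: sub_cg_contained => x y /orP[]; apply: path_edge_adj.
have mem (x : G) : X x -> exists y : F, val y = x by move=> h0; exists (Sub x h0).
have [|fa Ea] := mem a; first by rewrite /= !inE eqxx ?orbT.
have [|fb Eb] := mem b; first by rewrite /= !inE eqxx ?orbT.
have [|fc Ec] := mem c; first by rewrite /= !inE eqxx ?orbT.
have [|fd Ed] := mem d; first by rewrite /= !inE eqxx ?orbT.
have [|fa' Ea'] := mem a'; first by rewrite /= !inE eqxx ?orbT.
have [|fb' Eb'] := mem b'; first by rewrite /= !inE eqxx ?orbT.
have [|fc' Ec'] := mem c'; first by rewrite /= !inE eqxx ?orbT.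
have [|fd' Ed'] := mem d'; first by rewrite /= !inE eqxx ?orbT.
have Ep : p = map val [:: fa; fb; fc; fd] by rewrite /= Ea Eb Ec Ed.
have Ep' : p' = map val [:: fa'; fb'; fc'; fd'] by rewrite /= Ea' Eb' Ec' Ed'.
have card3 : #|[set fb; fc] :&: [set fb'; fc']| < 3.
  apply: leq_ltn_trans (subset_leq_card (subsetIl _ _)) _.
  by rewrite cards2; case: (_ != _).
exists (Ordinal card3), fa, fb, fc, fd, fa', fb', fc', fd'; split; split=> //.
- by rewrite -(map_inj_uniq val_inj) -Ep.
- by rewrite -(map_inj_uniq val_inj) -Ep'.
- by move=> x; rewrite -!(mem_map val_inj) -Ep -Ep'; apply: (valP x).
- move=> x y; rewrite -(path_edge_map [:: fa; fb; fc; fd] x y val_inj) -Ep.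
  by rewrite -(path_edge_map [:: fa'; fb'; fc'; fd'] x y val_inj) -Ep'.
- by rewrite /cross /= Eb Ec Eb' Ec' !hc; lia.
- by rewrite /cross /= Ea Eb Ec Ed Ea' Eb' Ec' Ed' !hc; lia.
- case: ifP => _; first by rewrite /cross /= Eb Ec Ea Ea' !hc; lia.
  apply/andP; split; apply/forall_inP=> x; rewrite !inE.
    case/andP=> nx /orP[]/eqP ex; subst x; rewrite /cross /= Eb Ec Ea ?Eb' ?Ec' !hc;
    by move: nx; rewrite -!(inj_eq val_inj) ?Eb ?Ec ?Eb' ?Ec' !eqh; lia.
  case/andP=> nx /orP[]/eqP ex; subst x; rewrite /cross /= Ea' ?Eb' ?Ec' ?Eb ?Ec !hc;
  by move: nx; rewrite -!(inj_eq val_inj) ?Eb ?Ec ?Eb' ?Ec' !eqh; lia.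
apply/setP=> x; rewrite !inE -!(inj_eq val_inj) Ea Eb Ec Ed Ea' Eb' Ec' Ed' !eqh.
by move: (h (val x)) => hx; lia.
Qed.

(** * Outer and inner centers in a 2-coloured cg tree *)

(* For an arc [X] of a 2-colouring; swapping the two arcs exchanges the two kinds
   of centers. *)
Definition crossing_center (G : cgGraph) (X : {set G}) (b c : G) : bool :=
  [&& b \in X, adj b c, [exists a, adj a b && cyc b a c]
    & [exists d, adj c d && cyc b d c]].

(** The coordinate on the two lines when [A] is an initial segment: rightwards means towards the
    ends of the linear order, down on [A] and up on its complement. *)
Definition outerness (G : finType) (A : {set G}) (h : G -> nat) (x : G) : int :=
  (if x \in A then - (h x)%:Z else (h x)%:Z)%R.

Lemma outerness_lt (G : finType) (A : {set G}) (h : G -> nat) x y :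
  (x \in A) = (y \in A) ->
  (outerness A h x < outerness A h y)%R = if x \in A then h y < h x else h x < h y.
Proof. by rewrite /outerness => <-; case: ifP => _; rewrite ?ltrN2 ltz_nat. Qed.

Lemma outerness_le (G : finType) (A : {set G}) (h : G -> nat) x y :
  (x \in A) = (y \in A) ->
  (outerness A h x <= outerness A h y)%R = if x \in A then h y <= h x else h x <= h y.
Proof. by rewrite /outerness => <-; case: ifP => _; rewrite ?lerN2 lez_nat. Qed.

Record bicolored (G : cgGraph) (A : {set G}) (h : G -> nat) (k : nat) : Prop :=
  Bicolored {
  bi_lin : linear_coordinate h;
  bi_in : forall x, (x \in A) = (h x < k);
  bi_adj : forall x y : G, adj x y -> (y \in A) = (x \notin A) }.

Lemma bicolored_two_line (T : cgGraph) (A : {set T}) (h : T -> nat) (k : nat) :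
  is_tree T ->
  (forall F : cgGraph, crossing_four_edge_path F -> ~ contains T F) ->
  bicolored A h k ->
  two_line (@adj T) [in A] (outerness A h).
Proof.
move=> hT hpath [[hi hc] hA bip]; split.
- exact: adj_sym.
- by case: hT.
- by move=> x y /bip ->.
- move=> x y /= sxy; rewrite /outerness -sxy.
  by case: ifP => _ => [/oppr_inj|] [/hi].
move=> a b c d e ab bc cd nac nbd eqr ae.
apply: (crossing_path_leaf hT hpath ab bc cd nac nbd _ ae).
have sb := bip _ _ ab; have sc := bip _ _ bc; have sd := bip _ _ cd.
(* The path alternates between the arcs, and [A] is the part below [k]; so [ab] and [cd] cross iff
   [h] orders [a], [c] as it orders [b], [d]. Reversing [h] on [A] gives the equality in
   [tl_leaf]. *)
move: eqr; rewrite !outerness_lt ?sd ?sc ?sb ?negbK // /cross !hc.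
have nac' : h a != h c by rewrite (inj_eq hi).
have nbd' : h b != h d by rewrite (inj_eq hi).
move: sb sc sd nac' nbd'; rewrite !hA; case: (ltnP (h a) k) => /= ak.
  by move=> *; lia.
by move=> *; lia.
Qed.

(** Clockwise from [b] to [c] the coordinate falls from [h b], wraps round to the top and falls to
    [h c]; so the ends [a] and [d] lie outside the interval spanned by [bc]. *)
Lemma crossing_center_outer (G : cgGraph) (A : {set G}) (h : G -> nat) (k : nat)
    (b c : G) :
  bicolored A h k -> b \in A -> adj b c ->
  crossing_center A b c <-> outer_center (@adj G) (outerness A h) b c.
Proof.
move=> [[hi hc] hA bip] bA bc; have cA : c \notin A by rewrite (bip _ _ bc) bA.
have [hb hk] : h b < k /\ k <= h c by rewrite -hA leqNgt -hA.
split.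
  case/and4P=> _ _ /existsP[a /andP[ab]] + /existsP[d /andP[cd]].
  have aA : a \notin A by rewrite (bip b) ?bA // adj_sym.
  have dA : d \in A by rewrite (bip c).
  rewrite !hc => ca bd; split=> //; exists a, d; split=> //.
    rewrite outerness_lt ?(negbTE aA) ?(negbTE cA) //.
    by move: aA; rewrite hA; lia.
  by rewrite outerness_lt bA ?dA //; move: dA; rewrite hA; lia.
case=> _ [a [d [ab cd ca bd]]].
have aA : a \notin A by rewrite (bip b) ?bA // adj_sym.
have dA : d \in A by rewrite (bip c).
move: ca bd; rewrite !outerness_lt ?bA ?dA ?(negbTE aA) ?(negbTE cA) // => ca bd.
apply/and4P; split=> //; apply/existsP; [exists a|exists d].
  by rewrite ab hc; lia.
by rewrite cd hc; lia.
Qed.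

(** Clockwise from [c] to [b] there is no wrapping, so the ends lie inside the interval spanned by
    [bc]. *)
Lemma crossing_center_inner (G : cgGraph) (A : {set G}) (h : G -> nat) (k : nat)
    (b c : G) :
  bicolored A h k -> b \in A -> adj b c ->
  crossing_center (~: A) c b <->
  outer_center (@adj G) (fun x => - outerness A h x)%R b c.
Proof.
move=> [[hi hc] hA bip] bA bc; have cA : c \notin A by rewrite (bip _ _ bc) bA.
have [hb hk] : h b < k /\ k <= h c by rewrite -hA leqNgt -hA.
split.
  case/and4P=> _ _ /existsP[d /andP[cd]] + /existsP[a /andP[ab]].
  rewrite adj_sym in ab; rewrite adj_sym in cd.
  have aA : a \notin A by rewrite (bip b) ?bA // adj_sym.
  have dA : d \in A by rewrite (bip c).
  rewrite !hc => bd ca; split=> //; exists a, d; split=> //; rewrite ltrN2.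
    rewrite outerness_lt ?(negbTE aA) ?(negbTE cA) //.
    by move: aA; rewrite hA; lia.
  by rewrite outerness_lt dA ?bA //; move: dA; rewrite hA; lia.
case=> _ [a [d [ab cd]]]; rewrite !ltrN2 => ca bd.
have aA : a \notin A by rewrite (bip b) ?bA // adj_sym.
have dA : d \in A by rewrite (bip c).
move: ca bd; rewrite !outerness_lt ?bA ?dA ?(negbTE aA) ?(negbTE cA) // => ca bd.
move: (aA) (dA); rewrite !hA => aA' dA'.
apply/and4P; split; rewrite ?inE ?cA //; first by rewrite adj_sym.
  by apply/existsP; exists d; rewrite adj_sym cd hc; lia.
by apply/existsP; exists a; rewrite adj_sym ab hc; lia.
Qed.

(** The endpoints of the inner center [bc] are not leaves, so by domination they lie within the
    outer center [b'c']. The two three-edge paths are then placed as in [family_P_contained]. *)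
Lemma no_outer_and_inner_center (T : cgGraph) (A : {set T}) (h : T -> nat) (k : nat)
    (b c b' c' : T) :
  is_tree T ->
  (forall F : cgGraph, crossing_four_edge_path F -> ~ contains T F) ->
  (forall F : cgGraph, in_family_P F -> ~ contains T F) ->
  bicolored A h k ->
  crossing_center A b' c' -> crossing_center (~: A) c b -> False.
Proof.
move=> hT hpath hP hB h' h0; have H := bicolored_two_line hT hpath hB.
have [bA' bc' _ _] := and4P h'; have [cA cb _ _] := and4P h0.
have [[hi hc] hA bip] := hB.
have bc : adj b c by rewrite adj_sym.
have bA : b \in A by move: cA; rewrite inE (bip _ _ bc) negbK.
have o' := (crossing_center_outer hB bA' bc').1 h'.
have o := (crossing_center_inner hB bA bc).1 h0.
rewrite inE in cA; have cA' : c' \notin A by rewrite (bip _ _ bc') bA'.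
have [_ [a [d [ab cd]]]] := o; rewrite !ltrN2 => ac db.
have [_ [a' [d' [ab' cd' ca' bd']]]] := o'.
have aA : a \notin A by rewrite (bip b) ?bA // adj_sym.
have dA : d \in A by rewrite (bip c).
have aA' : a' \notin A by rewrite (bip b') ?bA' // adj_sym.
have dA' : d' \in A by rewrite (bip c').
have sb : [in A] b = [in A] b' by rewrite /= bA bA'.
have sc : [in A] c = [in A] c' by rewrite /= (negbTE cA) (negbTE cA').
have lb : (outerness A h b <= outerness A h b')%R.
  have [//|[_ lf]] := outer_center_dominates H o' sb.
  have e1 := lf _ bc; have e2 : a = c' by apply: lf; rewrite adj_sym.
  by move: ac; rewrite e1 e2 ltxx.
have lc : (outerness A h c <= outerness A h c')%R.
  have [//|[_ lf]] := outer_center_dominates H (outer_centerC (@adj_sym T) o') sc.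
  have e1 : b = b' by apply: lf; rewrite adj_sym.
  by move: db; rewrite e1 (lf _ cd) ltxx.
move: ac db ca' bd' lb lc.
rewrite !outerness_le ?bA ?bA' ?(negbTE cA) ?(negbTE cA') //.
rewrite !outerness_lt ?bA ?bA' ?dA ?dA' ?(negbTE cA) ?(negbTE cA') ?(negbTE aA)
  ?(negbTE aA') // => ac db ca' bd' lb lc.
have [F FP] : exists2 F, in_family_P F & contains T F; last exact: hP FP.
rewrite hA in dA; rewrite hA in aA.
have sp : sorted (@adj T) [:: a; b; c; d] by rewrite /= ab bc cd.
have sp' : sorted (@adj T) [:: a'; b'; c'; d'] by rewrite /= ab' bc' cd'.
apply: (family_P_contained (conj hi hc) sp sp').
- by rewrite bd' lb.
- by rewrite db (leq_trans dA) // leqNgt.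
- by rewrite ac.
- by [].
Qed.

Lemma bicolored_z_tree (T : cgGraph) (A : {set T}) (h : T -> 'I_#|T|) (k : nat) :
  is_tree T ->
  (forall F : cgGraph, crossing_four_edge_path F -> ~ contains T F) ->
  bicolored A (fun x => h x) k -> bijective h ->
  A != set0 -> ~: A != set0 ->
  (forall b c, ~~ crossing_center (~: A) c b) ->
  cg_z_tree T.
Proof.
move=> hT hpath hB [g hK gK] /set0Pn[x0 x0A] /set0Pn[y0]; rewrite inE => y0A noin.
have H := bicolored_two_line hT hpath hB.
have [[hi hc] hA bip] := hB; set r := outerness _ _ in H.
pose E := [set e : 'I_#|T| * 'I_#|T| | [&& e.1 < k, k <= e.2 & adj (g e.1) (g e.2)]].
have EP x y : x \in A -> adj x y -> (h x, h y) \in E.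
  by move=> xA xy; rewrite inE /= !hK xy -hA xA andbT /= leqNgt -hA (bip _ _ xy) xA.
have hk : {in E, forall e : 'I_#|T| * 'I_#|T|, e.1 < k <= e.2}.
  by move=> e; rewrite inE => /and3P[-> ->].
have conn (W : pred 'I_#|T|) : {in E, forall e : 'I_#|T| * 'I_#|T|, W e.1 = W e.2} ->
    forall x y, W x = W y.
  move=> clE x y; have cl : closed (@adj T) [pred z | W (h z)].
    move=> u v uv; rewrite !inE; case: (boolP (u \in A)) => uA.
      exact: (clE (h u, h v) (EP _ _ uA uv)).
    by apply/esym/(clE (h v, h u)); apply: EP; rewrite ?(bip _ _ uv) // adj_sym.
  by have [_ /(_ (g x) (g y))/(closed_connect cl) + _] := hT; rewrite !inE !gK.
have inA i : (g i \in A) = (i < k) by rewrite hA gK.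
(* Edges with endpoints in the same order on both arcs cross. The connecting edge [xy'] would be an
   inner center, so it is [x'y], an outer one. *)
have nocross x y x' y' : x \in A -> adj x y -> x' \in A -> adj x' y' ->
    h x < h x' -> h y < h y' -> outer_center (@adj T) r x' y.
  move=> xA xy xA' xy' hx hy.
  have yA : y \notin A by rewrite (bip _ _ xy) xA.
  have yA' : y' \notin A by rewrite (bip _ _ xy') xA'.
  have rx : (r x' < r x)%R by rewrite outerness_lt xA' ?xA.
  have ry : (r y < r y')%R by rewrite outerness_lt (negbTE yA) ?(negbTE yA').
  have sx : [in A] x' = [in A] x by rewrite /= xA xA'.
  have [//|o] := crossing_edges_center H xy' xy sx rx ry.
  have [xy0 _] := o; have := noin x y'.
  by rewrite (crossing_center_inner hB xA xy0).2.
suff [b [c [bA bc dom nest]]] : exists b c : T, [/\ b \in A, adj b c,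
    forall x y, x \in A -> adj x y -> [\/ h b <= h x /\ h y <= h c,
      y = c /\ h x < h b | x = b /\ h c < h y]
  & forall x y x' y', x \in A -> adj x y -> x' \in A -> adj x' y' ->
      h b <= h x -> h y' <= h c -> h x < h x' -> h y' <= h y].
  exists #|T|, [set x : 'I_#|T| | x < k], [set x : 'I_#|T| | k <= x], E; split.
  - apply: (center_z_tree (EP _ _ bA bc) hk) => //.
      move=> [i j]; rewrite inE /= -inA => /and3P[iA _ ij].
      have := dom _ _ iA ij; rewrite !gK => -[[d1 d2]|[d1 d2]|[d1 d2]].
      + exact: Or31.
      + by apply: Or32; split=> //; rewrite -d1 gK.
      + by apply: Or33; split=> //; rewrite -d1 gK.
    move=> [i j] [i' j']; rewrite !inE /= -!inA.
    move=> /andP[/and3P[iA _ ij] /andP[b1 _]] /andP[/and3P[iA' _ ij'] /andP[_ b2]].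
    by have := nest _ _ _ _ iA ij iA' ij'; rewrite !gK => /(_ b1 b2).
  - by apply/setP=> x; rewrite !inE; case: ltnP.
  exists h; split=> [|x y z|x y]; first by exists g.
    by rewrite hc.
  have xyE u v : ((h u, h v) \in E) = (u \in A) && adj u v.
    rewrite inE /= !hK -hA; case: (boolP (u \in A)) => //= uA.
    apply/andP/idP=> [[]|uv] //; split=> //.
    by rewrite leqNgt -hA (bip _ _ uv) uA.
  rewrite /= /ord_adj !xyE (inj_eq (can_inj hK)) [adj y x]adj_sym -andb_orl.
  apply/idP/idP=> [/and3P[_ _]|xy] //; rewrite xy andbT (bip _ _ xy) orbN andbT.
  by apply: contraTneq xy => ->; rewrite adj_irr.
have [/existsP[[b c] /= bcC]|/existsPn nocent] :=
  boolP [exists e : T * T, crossing_center A e.1 e.2].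
  have [bA bc _ _] := and4P bcC; have o := (crossing_center_outer hB bA bc).1 bcC.
  have cA : c \notin A by rewrite (bip _ _ bc) bA.
  exists b, c; split=> // [x y xA xy|x y x' y' xA xy xA' xy' bx yc xx].
    have yA : y \notin A by rewrite (bip _ _ xy) xA.
    have sx : [in A] x = [in A] b by rewrite /= xA bA.
    have sy : [in A] y = [in A] c by rewrite /= (negbTE yA) (negbTE cA).
    have [xb|[cx lx]] := outer_center_dominates H o sx; last first.
      rewrite (lx _ xy); have [xb|bx] := ltnP (h x) (h b); first exact: Or32.
      exact: Or31.
    rewrite outerness_le ?xA ?bA // in xb.
    have [yc|[yb ly]] :=
      outer_center_dominates H (outer_centerC (@adj_sym T) o) sy.
      by apply: Or31; rewrite outerness_le (negbTE yA) ?(negbTE cA) // in yc.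
    have ex : x = b by apply: ly; rewrite adj_sym.
    have [yc|cy] := leqP (h y) (h c); first exact: Or31.
    exact: Or33.
  rewrite leqNgt; apply/negP=> yy.
  (* Crossing edges inside [bc] would make [x'y] an outer center, hence [b = x'] by uniqueness,
     although [h b <= h x < h x']. *)
  have o' := nocross _ _ _ _ xA xy xA' xy' xx yy.
  have sb : [in A] b = [in A] x' by rewrite /= bA xA'.
  have [ex _] := outer_center_unique H o o' sb.
  by move: bx; rewrite ex leqNgt xx.
have nest x y x' y' : x \in A -> adj x y -> x' \in A -> adj x' y' ->
    h x < h x' -> h y' <= h y.
  move=> xA xy xA' xy' xx; rewrite leqNgt; apply/negP=> yy.
  have o := nocross _ _ _ _ xA xy xA' xy' xx yy; have [xy0 _] := o.
  have /negP := nocent (x', y); apply=> /=.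
  exact/(crossing_center_outer hB xA' xy0).
have En0 : E != set0.
  apply/eqP=> E0; have := conn [pred z : 'I_#|T| | z < k] _ (h x0) (h y0).
  rewrite /= -!hA x0A (negbTE y0A) E0 => W.
  by suff : true = false by []; apply: W => e; rewrite inE.
have lt : {in E, forall e : 'I_#|T| * 'I_#|T|, e.1 < e.2}.
  by move=> e /hk/andP[]; apply: leq_trans.
have [|[i j] ijE out] := outermost_edge En0 lt.
  move=> [i j] [i' j']; rewrite !inE /= -!inA => /and3P[iA _ ij] /and3P[iA' _ ij'].
  by have := nest _ _ _ _ iA ij iA' ij'; rewrite !gK.
move: ijE; rewrite inE /= -inA => /and3P[iA _ ij]; exists (g i), (g j); split=> //.
  move=> x y xA xy; have [/= o1 o2] := out _ (EP _ _ xA xy).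
  by rewrite !gK; apply: Or31.
by move=> x y x' y' xA xy xA' xy' _ _; apply: nest.
Qed.

(** * Cutting the curve: linear coordinates from two arcs *)

Lemma cyc_neq (G : cgGraph) (x y z : G) : cyc x y z -> [&& x != y, y != z & x != z].
Proof.
have irr (u v : G) : cyc u u v = false.
  by apply/negP=> h; have := cyc_asym h; rewrite (cyc_rot (cyc_rot h)).
move=> h; apply/and3P; split; apply/eqP=> e; move: (h); rewrite e ?irr //.
- by move/cyc_rot; rewrite irr.
- by move/cyc_rot/cyc_rot; rewrite irr.
Qed.

(* Cutting the curve just after [v]: the coordinate counts the vertices met
   before [x] when travelling counterclockwise from [v]. *)
Lemma arc_coordinate (G : cgGraph) (u v : G) :
  exists (h : G -> 'I_#|G|) (k : nat),
    [/\ bijective h, linear_coordinate (fun x => h x)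
      & forall x, (x \in clockwise_arc u v) = (h x < k)].
Proof.
pose before (y x : G) := (y == v) && (x != v) || cyc v x y.
have trans x y z : before z y -> before y x -> before z x.
  case/orP=> [/andP[/eqP-> yv]|zy] /orP[/andP[/eqP ey xv]|yx].
  - by rewrite ey eqxx in yv.
  - have /and3P[vx _ _] := cyc_neq yx.
    by rewrite /before eqxx eq_sym vx.
  - by have /and3P[] := cyc_neq zy; rewrite ey eqxx.
  by rewrite /before (cyc_trans yx zy) orbT.
have irr x : before x x = false.
  apply/negP=> /orP[/andP[->]//|h].
  by have /and3P[_] := cyc_neq h; rewrite eqxx.
have total x y : x != y -> before x y || before y x.
  move=> xy; rewrite /before; have [ex|xv] := eqVneq x v.
    by rewrite -ex eq_sym xy.
  have [ey|yv] := eqVneq y v; first by rewrite /= orbT.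
  have := @cyc_total G v x y; rewrite /= !inE negb_or ![v == _]eq_sym xv yv xy.
  case/(_ isT)/orP=> [->|h]; first by rewrite orbT.
  by rewrite (cyc_rot (cyc_rot h)).
pose pos x := #|[set y | before y x]|.
have pos_lt x y : before x y -> pos x < pos y.
  move=> xy; apply: proper_card; apply/properP; split.
    by apply/subsetP=> z; rewrite !inE => /trans; apply.
  by exists x; rewrite inE ?irr.
have posE x y : (pos x < pos y) = before x y.
  apply/idP/idP=> [|/pos_lt//] xy; have [e|/total/orP[//|/pos_lt yx]] := eqVneq x y.
    by rewrite e ltnn in xy.
  by move: (ltn_trans xy yx); rewrite ltnn.
have pos_inj : injective pos.
  move=> x y e; apply/eqP/negPn/negP => /total.
  by rewrite -!posE e ltnn.
have pos_bound x : pos x < #|G|.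
  rewrite -cardsT; apply: proper_card; rewrite properE subsetT.
  by apply/subsetPn; exists x; rewrite inE ?irr.
have cycP x y z : before z y -> before y x -> cyc x y z.
  case/orP=> [/andP[/eqP-> yv]|zy] /orP[/andP[/eqP ey xv]|yx].
  - by rewrite ey eqxx in yv.
  - exact: cyc_rot yx.
  - by have /and3P[] := cyc_neq zy; rewrite ey eqxx.
  exact: cyc_rot (cyc_rot (cyc_trans (cyc_rot zy) (cyc_rot (cyc_rot yx)))).
(* Counterclockwise from [v], the arc is met first and ends with [u], so it occupies the positions
   from 0 to [pos u]. *)
pose h x := Ordinal (pos_bound x); exists h, (pos u).+1; split.
- apply: inj_card_bij; last by rewrite card_ord.
  by move=> x y [/pos_inj].
- split=> [x y /= /pos_inj //|x y z] /=.
  have fwd a b c : [|| pos c < pos b < pos a, pos a < pos c < pos b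
      | pos b < pos a < pos c] -> cyc a b c.
    rewrite !posE => /or3P[]/andP[h1 h2].
    + exact: cycP h1 h2.
    + exact: cyc_rot (cyc_rot (cycP _ _ _ h1 h2)).
    + exact: cyc_rot (cycP _ _ _ h1 h2).
  apply/idP/idP=> [xyz|]; last exact: fwd.
  have := cyc_asym xyz; apply: contraNT => n; apply: fwd.
  have /and3P[] := cyc_neq xyz; rewrite -!(inj_eq pos_inj).
  by move: n; lia.
move=> x; rewrite ltnS leqNgt posE /before inE.
have [->|xu] := eqVneq x u.
  by rewrite -/(before u u) irr.
have [->|xv] /= := eqVneq x v.
  rewrite andbF /=; apply/esym/negP=> hh.
  by have /and3P[] := cyc_neq hh; rewrite eqxx.
have [eu|uv] /= := eqVneq u v.
  rewrite eu /=; apply/negP=> hh.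
  by have /and3P[_ _] := cyc_neq hh; rewrite eqxx.
apply/idP/negP=> [uxv vxu|n].
  by have := cyc_asym uxv; rewrite vxu.
have := @cyc_total G v x u; rewrite /= !inE negb_or ![v == _]eq_sym xv uv xu.
by case/(_ isT)/orP.
Qed.

Lemma two_arcs (G : cgGraph) :
  chi_c G = 2 -> exists A : {set G},
    [/\ is_arc A && independent A, is_arc (~: A) && independent (~: A),
      A != set0 & ~: A != set0].
Proof.
rewrite /chi_c; case: ex_minnP => m /existsP[P /and3P[pP /eqP cP arcP]] _ m2.
move: cP; rewrite m2 => /eqP/cards2P[A [B [AB PE]]].
have [covP tP nP] := and3P pP.
have AP : A \in P by rewrite PE !inE eqxx.
have BP : B \in P by rewrite PE !inE eqxx orbT.
have EB : ~: A = B.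
  have dAB : [disjoint A & B] by apply: (trivIsetP tP).
  apply/setP=> x; rewrite inE; apply/idP/idP=> xA.
    have : x \in cover P by rewrite (eqP covP).
    by case/bigcupP=> X; rewrite PE !inE => /orP[]/eqP-> //; rewrite (negbTE xA).
  by rewrite (disjointFl dAB xA).
exists A; rewrite EB; split.
- exact: (forall_inP arcP).
- exact: (forall_inP arcP).
- by apply: contraNneq nP => <-.
- by apply: contraNneq nP => <-.
Qed.

Lemma bicolored_of_independent (G : cgGraph) (A : {set G}) (h : G -> nat) (k : nat) :
  linear_coordinate h -> (forall x, (x \in A) = (h x < k)) ->
  independent A -> independent (~: A) -> bicolored A h k.
Proof.
move=> hl hA iA iA'; split=> // x y xy.
case: (boolP (x \in A)) => xA /=.
  apply/negP => yA.
  by have /forall_inP/(_ _ xA)/forall_inP/(_ _ yA) := iA; rewrite xy.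
apply/negPn/negP => yA; move/forall_inP/(_ x): iA'; rewrite inE xA => /(_ isT).
by move/forall_inP/(_ y); rewrite inE yA xy => /(_ isT).
Qed.

Theorem theorem3p5 (T : cgGraph) (hT : is_tree T) (hchi : chi_c T = 2)
  (hpath : forall F : cgGraph, crossing_four_edge_path F -> ~ contains T F)
  (hP : forall F : cgGraph, in_family_P F -> ~ contains T F) :
  cg_z_tree T.
Proof.
(* Either arc can be made the initial segment; the choice amounts to the point where the curve is
   cut. *)
have coord (A : {set T}) : is_arc A -> independent A -> independent (~: A) ->
    exists (h : T -> 'I_#|T|) k, bijective h /\ bicolored A (fun x => h x) k.
  case/existsP=> u /existsP[v /eqP EA] iA iB.
  have [h [k [hb hl hA]]] := arc_coordinate u v.
  exists h, k; split=> //; apply: bicolored_of_independent => // x.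
  by rewrite EA hA.
have [A [/andP[arcA iA] /andP[arcB iB] An Bn]] := two_arcs hchi.
have [h [k [hb hA]]] := coord A arcA iA iB.
have [/existsP[[c b] /= inC]|/existsPn noin] :=
  boolP [exists e : T * T, crossing_center (~: A) e.1 e.2]; last first.
  by apply: (bicolored_z_tree hT hpath hA hb An Bn) => b c; apply: (noin (c, b)).
(* With the complement of [A] as initial segment, the inner center becomes outer. An inner center
   for this order would be an outer one for the first, and the two together would give a member of
   the family. *)
have [h' [k' [hb' hB]]] : exists (h : T -> 'I_#|T|) k,
    bijective h /\ bicolored (~: A) (fun x => h x) k.
  by apply: coord; rewrite ?setCK.
apply: (bicolored_z_tree hT hpath hB hb') => //; rewrite setCK // => b' c'.
by apply/negP=> outC; apply: (no_outer_and_inner_center hT hpath hP hA outC inC).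
Qed.
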